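(* Let $P$ be a finite poset with $|P|=n$. Let $e$ be a linear extension of $P$. Then the maximal chain descent order $J(P)_{\lambda_e}(2)$ is isomorphic to the order ideal $\mathcal L(P,e)$ of the weak order on $S_n$ via the map assigning to each maximal chain of $J(P)$ its label sequence with respect to $\lambda_e$.
   Context: $J(P)$ is the lattice of order ideals of $P$ ordered by inclusion. A linear extension of $P$ is an order preserving bijection $e:P\to\{1,\dots,n\}$. Each cover relation $I\lessdot I'$ in $J(P)$ has $I'=I\cup\{x\}$ for some $x\in P$, and $\lambda_e(I,I')=e(x)$; this is an EL-labeling of $J(P)$ for which the label sequence of every maximal chain is a permutation of $\{1,\dots,n\}$. $\mathcal L(P,e)$ is the set of permutations (in one-line notation) appearing as label sequences of maximal chains of $J(P)$ labeled by $\lambda_e$, with the order restricted from the weak order on $S_n$; it is an order ideal of the weak order. For a finite poset $Q$ with least element $\hat 0$ and greatest element $\hat 1$, $\mathcal M(Q)$ is the set of maximal chains. For a chain $c$ and $x\in c$ write $c^x=\{w\in c: w\le x\}$, $c_x=\{w\in c: w\ge x\}$. An edge labeling $\lambda$ assigns to each cover relation a label in a poset; a saturated chain gets the sequence of labels of its edges from bottom to top. A sequence is ascending if weakly increasing. $\lambda$ is an EL-labeling if for every $x<y$ the interval $[x,y]$ has a unique ascending maximal chain and it lexicographically precedes all other maximal chains of $[x,y]$. A saturated chain $u\lessdot v\lessdot w$ is a descent if $\lambda(u,v)\not\le\lambda(v,w)$. Polygon move: $m\to m'$ if there are $x<z$ in $m\cap m'$ with $m^x=m'^x$, $m_z=m'_z$,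 such that $m'\cap[x,z]$ is a descent $x\lessdot y\lessdot z$ with $y\notin m$, while $m\cap[x,z]$ is the unique ascending maximal chain of $[x,z]$. The maximal chain descent order $Q_\lambda(2)$ is $\mathcal M(Q)$ partially ordered by the reflexive and transitive closure of $\to$. The weak order on $S_n$ is the (right) weak order: $u\le_{wk}w$ iff $w=us_{i_1}\cdots s_{i_k}$ with $s_i=(i,i+1)$ and $\ell(us_{i_1}\cdots s_{i_j})=\ell(u)+j$ for all $1\le j\le k$, where $\ell$ is the number of inversions; right multiplication by $s_i$ swaps the entries in positions $i,i+1$. *)

(* Defs.v *)
From HB Require Import structures.
From mathcomp Require Import all_boot all_order all_fingroup.

Set Implicit Arguments.
Unset Strict Implicit.
Unset Printing Implicit Defensive.

Import Order.TTheory Order.DefaultSetSubsetOrder.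

Section MaximalChains.
Context {d : Order.disp_t} {Q : finTBPOrderType d}.
Implicit Types (x y z : Q) (A c : {set Q}).

Definition covers x y : bool :=
  (x < y)%O && [forall z, ~~ ((x < z)%O && (z < y)%O)].

Definition is_chain c : bool :=
  [forall x in c, forall y in c, (x >=< y)%O].

Definition itv x y : {set Q} := [set w | (x <= w)%O && (w <= y)%O].

Definition max_chain_of A c : bool :=
  maxset (fun c' : {set Q} => is_chain c' && (c' \subset A)) c.

(* c^x and c_x *)
Definition chain_below c x : {set Q} := [set w in c | (w <= x)%O].
Definition chain_above c x : {set Q} := [set w in c | (x <= w)%O].

(* An edge labeling is given as a total function lam : Q -> Q -> L; it is only
   ever evaluated on consecutive elements of saturated chains, so its values
   off the cover relations are irrelevant. *)
Context {dL : Order.disp_t} {L : porderType dL}.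
Variable lam : Q -> Q -> L.

Definition label_seq c : seq L :=
  if sort <=%O (enum c) is x :: s then pairmap lam x s else [::].

Definition ascending c : bool := sorted <=%O (label_seq c).

Definition EL_labeling : Prop :=
  forall x y, (x < y)%O ->
  exists2 c, max_chain_of (itv x y) c && ascending c &
    forall c', max_chain_of (itv x y) c' -> c' != c ->
      ~~ ascending c' /\
      ((label_seq c : seqlexi L) < (label_seq c' : seqlexi L))%O.

Definition unique_ascending_chain x z c : bool :=
  [&& max_chain_of (itv x z) c, ascending c &
   [forall c', max_chain_of (itv x z) c' && ascending c' ==> (c' == c)]].

Definition descent x y z : bool :=
  [&& covers x y, covers y z & ~~ (lam x y <= lam y z)%O].

Definition max_chain : Type := {c : {set Q} | max_chain_of [set: Q] c}.

Definition polygon_move : rel max_chain := fun mm mm' =>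
  let m := val mm in let m' := val mm' in
  [exists x in m :&: m', exists z in m :&: m',
    [&& (x < z)%O,
        chain_below m x == chain_below m' x,
        chain_above m z == chain_above m' z,
        [exists y, [&& descent x y z,
                       m' :&: itv x z == [set x; y; z] & y \notin m]] &
        unique_ascending_chain x z (m :&: itv x z)]].

(* Q_lam(2) *)
Definition mcd_le : rel max_chain := connect polygon_move.

End MaximalChains.

Arguments max_chain {d} Q.

Section OrderIdeals.
Context {d : Order.disp_t} {P : finPOrderType d}.

Definition down_closed : {pred {set P}} :=
  fun A => [forall x in A, forall y, (y <= x)%O ==> (y \in A)].

Lemma down_closedP (A : {set P}) :
  reflect (forall x y, x \in A -> (y <= x)%O -> y \in A) (down_closed A).
Proof.
apply: (iffP forall_inP) => [h x y /h/forallP/(_ y)/implyP //|h x xA].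
by apply/forallP => y; apply/implyP; apply: h.
Qed.

Fact down_closedI : meet_closed down_closed.
Proof.
move=> A B /down_closedP hA /down_closedP hB; apply/down_closedP => x y.
by rewrite !inE => /andP[/hA yA /hB yB] le; rewrite yA ?yB.
Qed.

Fact down_closedU : join_closed down_closed.
Proof.
move=> A B /down_closedP hA /down_closedP hB; apply/down_closedP => x y.
by rewrite !inE => /orP[/hA h|/hB h] /h ->; rewrite ?orbT.
Qed.

Fact down_closed0 : \bot%O \in down_closed.
Proof. by apply/down_closedP => x y; rewrite in_set0. Qed.

Fact down_closed1 : \top%O \in down_closed.
Proof. by apply/down_closedP => x y; rewrite !in_setT. Qed.

HB.instance Definition _ := Order.isTBLatticeClosed.Build _ _ down_closed
  down_closedI down_closedU down_closed0 down_closed1.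

Record ideal := Ideal { ideal_set :> {set P}; _ : ideal_set \in down_closed }.

HB.instance Definition _ := [isSub for ideal_set].
HB.instance Definition _ := [Finite of ideal by <:].
HB.instance Definition _ := [SubChoice_isTBSubLattice of ideal by <:
  with Order.SetSubsetOrder.subset_display].

End OrderIdeals.

(* J(P), ordered by inclusion *)
Arguments ideal {d} P.

(* {1, ..., n} is represented by 'I_n = {0, ..., n - 1}. *)
Definition linear_extension (d : Order.disp_t) (P : finPOrderType d) (n : nat)
    (e : P -> 'I_n) : Prop :=
  bijective e /\ {homo e : x y / (x <= y)%O >-> (x <= y)%N}.

(* lambda_e(I, I') = e(x) when I' = I U {x}; 0 is a dummy value. *)
Definition ideal_label (d : Order.disp_t) (P : finPOrderType d) (n : nat)
    (e : P -> 'I_n) (I I' : ideal P) : nat :=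
  if [pick x in ideal_set I' :\: ideal_set I] is Some x then e x else 0.

Definition one_line (n : nat) (w : 'S_n) : seq nat :=
  [seq (w i : nat) | i <- enum 'I_n].

Definition inversion_number (n : nat) (w : 'S_n) : nat :=
  #|[set ij : 'I_n * 'I_n | (ij.1 < ij.2) && (w ij.2 < w ij.1)]|.

Definition simple_transposition (n : nat) (s : 'S_n) : bool :=
  [exists i : 'I_n, exists j : 'I_n, (j == i.+1 :> nat) && (s == tperm i j)].

(* u s_1 ... s_k, with permutations composed from right to left; since
   (s * u)%g i = u (s i), right multiplication by s is (s * _)%g here, and for
   s = (i, i + 1) it swaps the entries of u in positions i and i + 1. *)
Definition right_mul_word (n : nat) (u : 'S_n) (ss : seq 'S_n) : 'S_n :=
  foldl (fun v s => (s * v)%g) u ss.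

Definition weak_le (n : nat) (u w : 'S_n) : Prop :=
  exists ss : seq 'S_n,
    [/\ all (@simple_transposition n) ss,
        w = right_mul_word u ss &
        forall j : nat, 1 <= j <= size ss ->
          inversion_number (right_mul_word u (take j ss))
          = inversion_number u + j].

(* L(P, e) *)
Definition linext_perms (d : Order.disp_t) (P : finPOrderType d) (n : nat)
    (e : P -> 'I_n) : {set 'S_n} :=
  [set w | [exists m : max_chain (ideal P),
              one_line w == label_seq (ideal_label e) (val m)]].

(* Main.v *)
Require Import Defs.
From mathcomp Require Import all_boot all_order all_fingroup.
From mathcomp Require Import zify.

(** A saturated chain of order ideals from I to J adds the elements of J \ I
    one at a time, and the orders in which this is possible are the linear
    extensions of J \ I.  So a maximal chain of J(P) is the same thing as a
    linear extension s of P ([path_linear_word], [linear_word_path]), and its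
    label sequence is the word e(s).  As e is injective, labels determine the
    chain ([path_label_inj]).

    EL-labeling: all chains of [I, J] are labeled by rearrangements of one and
    the same set e(J \ I).  Since e is itself a linear extension, the increasing
    rearrangement is the label sequence of a chain ([increasing_word]), and it
    is the lexicographically least one ([sorted_lexi_min]).

    Order: both orders are the reflexive transitive closure of one relation
    between words, [ascent_swap], which turns consecutive letters a < b into
    b, a.  A descent x < y < z of a maximal chain has labels b > a; the other
    chains of [x, z] are labeled by rearrangements of the word ba, so the
    increasing one has labels ab, and a polygon move is exactly an ascent swap
    of the label sequence ([polygon_move_ascent_swap],
    [ascent_swap_polygon_move]).  On the side of permutations, multiplying by a
    simple transposition creates one inversion precisely when it swaps an ascent
    ([inversion_number_ascent]), so the weak order is generated by the same
    swaps ([weak_le_connect], [weak_step_swap]).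

    Order ideal: if the label sequence of a chain has a descent b, a at the
    elements y, x of P, then e(x) < e(y) forbids y < x, so x may be added before
    y, and undoing the swap gives the label sequence of another chain
    ([weak_step_linext_perms]).  Hence a path of weak order covers that ends in
    L(P, e) stays in L(P, e) and lifts to a path of polygon moves. *)

Set Implicit Arguments.
Unset Strict Implicit.
Unset Printing Implicit Defensive.

Import Order.TTheory Order.DefaultSetSubsetOrder.

(** * Words *)

Lemma map_cat_inv (T S : Type) (f : T -> S) s l1 l2 : map f s = l1 ++ l2 ->
  exists s1 s2, [/\ s = s1 ++ s2, map f s1 = l1 & map f s2 = l2].
Proof.
elim: l1 s => [|b l1 IH] s; first by exists [::], s.
case: s => [|a s] //= [<- /IH[s1 [s2 [-> <- <-]]]].
by exists (a :: s1), s2.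
Qed.

Lemma pairmap_eq_cat (T S : Type) (f : T -> T -> S) x p l1 l2 :
  pairmap f x p = l1 ++ l2 -> exists p1 p2,
    [/\ p = p1 ++ p2, pairmap f x p1 = l1 & pairmap f (last x p1) p2 = l2].
Proof.
elim: l1 x p => [|a l1 IH] x p; first by exists [::], p.
case: p => [|y p] //= [<- /IH[p1 [p2 [-> <- <-]]]].
by exists (y :: p1), p2.
Qed.

(** At the first place where the words differ, the increasing one has the
    smaller letter, since its letter there is the least of those not yet used. *)
Lemma sorted_lexi_min (d : Order.disp_t) (T : orderType d) (s t : seq T) :
  sorted <=%O s -> perm_eq s t -> ((s : seqlexi T) <= (t : seqlexi T))%O.
Proof.
elim: s t => [|x s IH] [|y t] //; try by move=> _ /perm_size.
rewrite [sorted _ _](path_sortedE le_trans) => /andP[/allP xs ss] st.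
rewrite lexi_cons; apply/andP; split.
  have : y \in x :: s by rewrite (perm_mem st) mem_head.
  by rewrite in_cons => /predU1P[->|/xs].
apply/implyP=> yx; apply: IH => //.
have xy : x = y.
  apply/le_anti; rewrite yx andbT.
  have : y \in x :: s by rewrite (perm_mem st) mem_head.
  by rewrite in_cons => /predU1P[->|/xs].
by move: st; rewrite xy perm_cons.
Qed.

(** The common generator of the two orders: the polygon moves, read on label
    sequences, and the covers of the weak order, read on one-line notations. *)
Definition ascent_swap (s t : seq nat) : Prop :=
  exists l1 a b l2, [/\ a < b, s = l1 ++ a :: b :: l2 & t = l1 ++ b :: a :: l2].

(** * Maximal chains of intervals as saturated paths *)

Section SaturatedChains.
Context {d : Order.disp_t} {Q : finTBPOrderType d}.
Implicit Types (x y z w : Q) (c : {set Q}) (p : seq Q).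

Lemma covers_lt x y : covers x y -> (x < y)%O.
Proof. by case/andP. Qed.

Lemma covers_itv x y w : covers x y -> (x <= w)%O -> (w <= y)%O ->
  w = x \/ w = y.
Proof.
case/andP=> _ /forallP/(_ w); rewrite !lt_neqAle => h xw wy.
case: (eqVneq w x) => [|nx]; [by left|case: (eqVneq w y) => [|ny]; [by right|]].
by move: h; rewrite xw wy ny eq_sym nx.
Qed.

Lemma path_covers_lt x p : path covers x p -> path <%O x p.
Proof. exact: sub_path covers_lt x p. Qed.

Lemma mem_path_ge x p w : path <%O x p -> w \in x :: p -> (x <= w)%O.
Proof.
rewrite (path_sortedE lt_trans) inE => /andP[/allP h _] /predU1P[->//|/h].
exact: ltW.
Qed.

Lemma mem_path_le x p w : path <%O x p -> w \in x :: p -> (w <= last x p)%O.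
Proof.
elim: p x w => [|a p IH] x w /=; first by rewrite inE => _ /eqP->.
case/andP=> xa pa; rewrite inE => /predU1P[->|]; last exact: IH.
exact: le_trans (ltW xa) (IH _ _ pa (mem_head _ _)).
Qed.

Lemma path_total x p : path <%O x p ->
  {in x :: p &, forall a b, (a <= b)%O || (b <= a)%O}.
Proof.
move=> px a b ain bin.
have px' : sorted <=%O (x :: p) by apply: sub_path px => ? ?; exact: ltW.
have h := sorted_leq_nth le_trans le_refl x px'.
rewrite -(nth_index x ain) -(nth_index x bin).
by case/orP: (leq_total (index a (x :: p)) (index b (x :: p))) => le;
  apply/orP; [left|right]; apply: h le;
  rewrite -[_ \in _]/(_ < size (x :: p))%N index_mem.
Qed.

(** Label sequences are defined by sorting the elements of a chain; this is
    what makes them computable from a path. *)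
Lemma sort_enum_path x p : path <%O x p ->
  sort <=%O (enum [set:: x :: p]) = x :: p.
Proof.
move=> px.
have px' : sorted <=%O (x :: p) by apply: sub_path px => ? ?; exact: ltW.
apply: le_sorted_eq => //.
- apply: (sort_sorted_in (P := [in x :: p])); last first.
    by apply/allP=> z; rewrite mem_enum in_set.
  exact: path_total.
- rewrite perm_sort; apply: uniq_perm; first exact: enum_uniq.
    by apply: (@lt_sorted_uniq _ _ (x :: p)).
  by move=> z; rewrite mem_enum inE.
Qed.

Lemma is_chain_path x p : path <%O x p -> is_chain [set:: x :: p].
Proof.
move=> px; apply/forall_inP=> a; rewrite inE => ain.
apply/forall_inP=> b; rewrite inE => bin.
exact: path_total px _ _ ain bin.
Qed.

Lemma label_seq_path (dL : Order.disp_t) (L : porderType dL) (lam : Q -> Q -> L)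
  x p : path covers x p -> label_seq lam [set:: x :: p] = pairmap lam x p.
Proof. by move/path_covers_lt/sort_enum_path; rewrite /label_seq => ->. Qed.

(** Saturated chains are maximal: w cannot lie strictly between consecutive
    elements, because these form a cover relation. *)
Lemma comparable_mem_path x p w : path covers x p ->
  (x <= w)%O -> (w <= last x p)%O -> {in x :: p, forall v, (w >=< v)%O} ->
  w \in x :: p.
Proof.
elim: p x => [|a p IH] x /=.
  by move=> _ xw wx _; rewrite inE; apply/eqP/le_anti; rewrite wx.
case/andP=> xa pa xw wl cmp; have ain : a \in x :: a :: p by rewrite !inE eqxx orbT.
case/orP: (cmp a ain) => [wa|aw].
  by case: (covers_itv xa xw wa) => ->; rewrite ?mem_head.
by rewrite inE IH ?orbT // => v vin; apply: cmp; rewrite inE vin orbT.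
Qed.

Lemma is_chainP c : reflect {in c &, forall a b, (a >=< b)%O} (is_chain c).
Proof.
apply: (iffP forall_inP) => [h a b /h/forall_inP|h a ain]; first exact.
by apply/forall_inP=> b; apply: h.
Qed.

(** Maximality by inclusion gives saturation: an element strictly between two
    consecutive elements of c would be comparable to all of c, hence in c. *)
Lemma max_chain_ofP x y c : (x <= y)%O ->
  reflect (exists p, [/\ path covers x p, last x p = y & c = [set:: x :: p]])
          (max_chain_of (itv x y) c).
Proof.
move=> xy; apply: (iffP idP) => [/maxsetP[]|[p [px lp ->]]]; last first.
  have plt := path_covers_lt px.
  apply/maxsetP; split.
    rewrite is_chain_path //=; apply/subsetP=> w; rewrite !inE => win.
    by rewrite (mem_path_ge plt) //= -lp (mem_path_le plt).
  move=> c' /andP[/is_chainP ch /subsetP sub] sub'.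
  apply/eqP; rewrite eqEsubset sub' andbT; apply/subsetP=> w wc'.
  have := sub w wc'; rewrite !inE -in_cons => /andP[xw wy].
  apply: comparable_mem_path; rewrite ?lp // => v vin; apply: ch => //.
  by apply: (subsetP sub'); rewrite inE.
case/andP=> /is_chainP ch /subsetP sub mx.
(* Maximality: anything in the interval comparable to all of c is in c. *)
have add w : (x <= w <= y)%O -> {in c, forall v, (w >=< v)%O} -> w \in c.
  move=> wi cmp; rewrite -(mx (w |: c)) ?setU11 ?subsetUr //.
  apply/andP; split; last first.
    by apply/subsetP=> v; rewrite in_setU1 => /predU1P[->|/sub//]; rewrite inE.
  apply/is_chainP=> a b; rewrite !in_setU1 => /predU1P[->|ac] /predU1P[->|bc] //.
  - exact: comparablexx.
  - exact: cmp.
  - by rewrite comparable_sym; apply: cmp.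
  - exact: ch.
have sub2 v : v \in c -> (x <= v <= y)%O by move/sub; rewrite inE.
have xc : x \in c.
  by apply: add; rewrite ?lexx // => v /sub2/andP[xv _]; apply/orP; left.
have yc : y \in c.
  by apply: add; rewrite ?lexx ?xy // => v /sub2/andP[_ vy]; apply/orP; right.
have: sorted <=%O (sort <=%O (enum c)).
  apply: (sort_sorted_in (P := [in c])); last by apply/allP=> z; rewrite mem_enum.
  exact: ch.
have: uniq (sort <=%O (enum c)) by rewrite sort_uniq enum_uniq.
have: sort <=%O (enum c) =i c by move=> v; rewrite mem_sort mem_enum.
case: (sort _ _) => [|x' p] mem un srt; first by have := mem x; rewrite xc.
have plt : path <%O x' p by rewrite -[path _ _ _]/(sorted _ (_ :: _)) lt_sorted_uniq_le un.
have x'x : x' = x.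
  have x'c : x' \in c by rewrite -mem mem_head.
  apply/le_anti; rewrite (mem_path_ge plt) ?mem //=.
  by case/andP: (sub2 _ x'c).
subst x'; exists p; split; last by apply/setP=> v; rewrite inE mem.
- apply/(pathP x) => i ip; rewrite /covers; set a := nth x (x :: p) i.
  set b := nth x p i; have iq : i < size (x :: p) by apply: leq_trans ip _.
  have ab : (a < b)%O by move/(pathP x): plt; exact.
  rewrite ab; apply/forallP=> z; apply/negP=> /andP[az zb].
  have nthle := sorted_leq_nth le_trans le_refl x srt.
  have cmp v : v \in c -> (v <= a)%O \/ (b <= v)%O.
    rewrite -mem => vin; rewrite -(nth_index x vin).
    case: (leqP (index v (x :: p)) i) => k; [left|right].
      by apply: nthle; rewrite ?inE ?index_mem.
    by apply: (nthle i.+1) => //; rewrite ?inE ?index_mem.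
  have zc : z \in c.
    have ac : a \in c by rewrite -mem mem_nth.
    have bc : b \in c by rewrite -mem inE mem_nth ?orbT.
    apply: add.
      case/andP: (sub2 _ ac) => xa _; case/andP: (sub2 _ bc) => _ yb.
      by rewrite (le_trans xa (ltW az)) (le_trans (ltW zb) yb).
    move=> v /cmp[va|bv]; apply/orP; [right|left].
      exact: le_trans va (ltW az).
    exact: le_trans (ltW zb) bv.
  case: (cmp _ zc) => h.
    by have := lt_le_trans az h; rewrite ltxx.
  by have := le_lt_trans h zb; rewrite ltxx.
- have lc : last x p \in c by rewrite -mem mem_last.
  apply/le_anti; rewrite (mem_path_le plt) ?mem // andbT.
  by case/andP: (sub2 _ lc).
Qed.

Lemma path_max_chain x p : path covers x p ->
  max_chain_of (itv x (last x p)) [set:: x :: p].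
Proof.
move=> pp; apply/max_chain_ofP; last by exists p.
exact: mem_path_le (path_covers_lt pp) (mem_head _ _).
Qed.

Lemma covers_mem_itv x y z : covers x y -> covers y z -> y \in itv x z.
Proof. by move=> /covers_lt xy /covers_lt yz; rewrite in_set !ltW. Qed.

Lemma max_chain_path (m : max_chain Q) :
  exists p, [/\ path covers \bot%O p, last \bot%O p = \top%O
              & val m = [set:: \bot%O :: p]].
Proof.
apply/max_chain_ofP; first exact: le0x.
suff -> : itv \bot%O \top%O = [set: Q] by exact: (valP m).
by apply/setP=> x; rewrite !inE le0x lex1.
Qed.

Lemma chain_split x p1 p2 : path covers x (p1 ++ p2) ->
  let z := last x p1 in
  chain_below [set:: x :: p1 ++ p2] z = [set:: x :: p1] /\
  chain_above [set:: x :: p1 ++ p2] z = [set:: z :: p2].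
Proof.
rewrite cat_path /= => /andP[/path_covers_lt h1 /path_covers_lt h2].
split; apply/setP=> w; rewrite !in_set in_cons mem_cat; apply/andP/idP.
- case=> /or3P[/eqP->|w1|w2 wz]; rewrite ?mem_head // inE ?w1 ?orbT //.
  have zw : (last x p1 <= w)%O by apply: (mem_path_ge h2); rewrite inE w2 orbT.
  have -> : w = last x p1 by apply/le_anti; rewrite wz.
  by rewrite -in_cons mem_last.
- by move=> w1; rewrite orbA -in_cons w1 (mem_path_le h1).
- case=> w12 zw; rewrite orbA -in_cons in w12; rewrite in_cons.
  case/orP: w12 => [w1|->]; last by rewrite orbT.
  apply/orP; left; apply/eqP/le_anti; rewrite zw andbT.
  exact: (mem_path_le h1).
- move=> w2; rewrite orbA -in_cons (mem_path_ge h2) //.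
  by rewrite in_cons in w2; case/predU1P: w2 => [->|->]; rewrite ?mem_last ?orbT.
Qed.

End SaturatedChains.

Section SplitChains.
Context {d : Order.disp_t} {Q : finTBPOrderType d}.
Implicit Types (x z : Q) (p : seq Q) (m : max_chain Q).

Lemma chain_split3 x p1 p2 p3 : path covers x (p1 ++ p2 ++ p3) ->
  let y := last x p1 in let z := last y p2 in
  let c := [set:: x :: p1 ++ p2 ++ p3] in
  [/\ chain_below c y = [set:: x :: p1], chain_above c z = [set:: z :: p3]
    & [/\ c :&: itv y z = [set:: y :: p2], y \in c & z \in c]].
Proof.
move=> pp y z c; have [b1 a1] := chain_split pp.
have pp2 : path covers y (p2 ++ p3) by move: pp; rewrite cat_path => /andP[].
have [b2 a2] := chain_split pp2.
rewrite -a1 in b2 a2; split=> //.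
  move: (pp); rewrite catA => /chain_split[_].
  by rewrite -catA last_cat => ->.
have yc : y \in chain_below c y by rewrite b1 in_set mem_last.
have zc : z \in chain_below (chain_above c y) z by rewrite b2 in_set mem_last.
split; first by rewrite -b2; apply/setP=> w; rewrite !in_set andbA.
  by move: yc; rewrite in_set => /andP[].
by move: zc; rewrite in_set => /andP[]; rewrite in_set => /andP[].
Qed.

Context {dL : Order.disp_t} {L : porderType dL} (lam : Q -> Q -> L).

(** A polygon move compares two maximal chains piece by piece, below x, inside
    [x, z] and above z; label sequences split accordingly. *)
Lemma max_chain_split m x z : x \in val m -> z \in val m -> (x <= z)%O ->
  exists p2, [/\ path covers x p2, last x p2 = z,
   val m :&: itv x z = [set:: x :: p2] &
   label_seq lam (val m) = label_seq lam (chain_below (val m) x) ++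
     pairmap lam x p2 ++ label_seq lam (chain_above (val m) z)].
Proof.
have [p [pp lp ->]] := max_chain_path m => xm zm xz.
rewrite in_set in xm.
case/splitPl: xm pp lp zm => p1 q lx pp lq zm.
have /chain_split[_ aE] := pp; rewrite lx in aE.
have : z \in chain_above [set:: \bot%O :: p1 ++ q] x by rewrite inE zm xz.
rewrite aE in_set => zq.
case/splitPl: zq pp lq {zm aE} => p2 p3 lz pp lq.
have /= := chain_split3 pp; rewrite lx lz => -[-> -> [-> _ _]].
rewrite label_seq_path // pairmap_cat lx pairmap_cat lz.
move: pp; rewrite !cat_path lx lz => /and3P[p1P p2P p3P].
by exists p2; split; rewrite // ?label_seq_path.
Qed.

End SplitChains.

(** * Saturated chains of order ideals as linear extensions *)

Section IdealCovers.
Context {d : Order.disp_t} {P : finPOrderType d}.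
Implicit Types (I J : ideal P) (x y : P) (s : seq P).

Lemma le_ideal I J : (I <= J)%O = (ideal_set I \subset ideal_set J).
Proof. by rewrite leEsub Order.SetSubsetOrder.Exports.leEsubset. Qed.

Lemma lt_ideal I J : (I < J)%O = (ideal_set I \proper ideal_set J).
Proof. by rewrite lt_neqAle le_ideal properEneq -(inj_eq val_inj). Qed.

Lemma ideal_down I x y : x \in ideal_set I -> (y <= x)%O -> y \in ideal_set I.
Proof. by case: I => A /= /down_closedP; apply. Qed.

Lemma ideal0 : ideal_set (\bot%O : ideal P) = set0.
Proof.
apply/eqP; rewrite -subset0.
by have := le0x (Ideal down_closed0 : ideal P); rewrite le_ideal.
Qed.

Lemma ideal1 : ideal_set (\top%O : ideal P) = setT.
Proof.
apply/eqP; rewrite -subTset.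
by have := lex1 (Ideal down_closed1 : ideal P); rewrite le_ideal.
Qed.

(** The smaller elements of x lie in J, which is an ideal, hence in I by
    minimality; so adding x to I gives an ideal again. *)
Lemma ideal_add_minimal I J x : (I <= J)%O -> x \in ideal_set J ->
  {in J :\: I, forall y, ~~ (y < x)%O} ->
  exists K : ideal P, K = x |: I :> {set P}.
Proof.
rewrite le_ideal => /subsetP IJ xJ xmin.
suff dn : (x |: I) \in down_closed by exists (Ideal dn).
apply/down_closedP => y z; rewrite !in_setU1 => /predU1P[->|yI] zy.
  case: eqVneq => //= nzx; apply: contraT => nzI.
  have := xmin z; rewrite in_setD nzI (ideal_down xJ zy) lt_neqAle nzx zy.
  by move/(_ isT).
by rewrite (ideal_down yI zy) orbT.
Qed.

Lemma exists_minimal (A : {set P}) : A != set0 ->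
  exists2 x, x \in A & {in A, forall y, ~~ (y < x)%O}.
Proof.
case/set0Pn=> x0 x0A.
case: (arg_minnP (fun x => #|[set y | (y < x)%O]|) x0A) => x xA xmin.
exists x => // y yA; apply/negP=> yx; have := xmin y yA; rewrite leqNgt => /negP; apply.
apply: proper_card; apply/properP; split.
  by apply/subsetP=> z; rewrite !inE => zy; apply: lt_trans yx.
by exists y; rewrite inE ?ltxx.
Qed.

(** If J covers I, adding to I a minimal element of J \ I gives an ideal between
    I and J that is not I, so it is J. *)
Lemma ideal_coversP I J :
  reflect (exists2 x, x \notin ideal_set I & J = x |: I :> {set P})
          (covers I J).
Proof.
apply: (iffP idP) => [cov|[x nxI eJ]].
  have := covers_lt cov; rewrite lt_ideal properEneq => /andP[nIJ sIJ].
  have IJ : (I <= J)%O by rewrite le_ideal.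
  have /exists_minimal[x] : J :\: I != set0.
    by apply: contraNneq nIJ => /eqP; rewrite setD_eq0 eqEsubset sIJ.
  rewrite in_setD => /andP[nxI xJ] /(ideal_add_minimal IJ xJ)[K eK].
  exists x => //; rewrite -eK.
  have IK : (I <= K)%O by rewrite le_ideal eK subsetUr.
  have KJ : (K <= J)%O by rewrite le_ideal eK subUset sub1set xJ.
  case: (covers_itv cov IK KJ) => [E|-> //].
  by move: nxI; rewrite -E eK setU11.
rewrite /covers lt_ideal eJ properEneq subsetUr andbT.
apply/andP; split; first by apply: contraNneq nxI => ->; rewrite setU11.
apply/forallP=> K; rewrite !lt_ideal eJ; apply/negP=> /andP[/proper_card h1].
by move/proper_card; rewrite cardsU1 nxI leqNgt ltnS h1.
Qed.

(** The linear extensions of the subposet A, written as words.  Asking only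
    that no later letter be smaller makes this stable under swapping letters
    ([linear_word_swap]). *)
Definition linear_word (A : {set P}) s : bool :=
  perm_eq s (enum A) && pairwise (fun x y => ~~ (y < x)%O) s.

Context {n : nat} (e : P -> 'I_n).

Lemma ideal_label_add I J x :
  x \notin ideal_set I -> J = x |: I :> {set P} -> ideal_label e I J = e x.
Proof.
move=> nxI eJ; rewrite /ideal_label eJ.
have -> : (x |: I) :\: I = [set x].
  by rewrite setDUl setDv setU0; apply/setDidPl; rewrite disjoints1.
by case: pickP => [y|/(_ x)]; rewrite in_set1 ?eqxx // => /eqP->.
Qed.

(** The elements are listed in the order in which the chain adds them: what
    lies below an added element was in I or has been added before. *)
Lemma path_linear_word I p : path covers I p ->
  exists2 s, linear_word (last I p :\: I) s &
    pairmap (ideal_label e) I p = [seq (e x : nat) | x <- s].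
Proof.
elim: p I => [|J p IH] I /=.
  by exists [::] => //; rewrite setDv /linear_word enum_set0.
case/andP=> IJ pp; have [s /andP[sB sw] ->] := IH J pp.
have [x nxI eJ] := ideal_coversP _ _ IJ.
have JB : (J <= last J p)%O.
  by apply: mem_path_ge (path_covers_lt pp) (mem_last _ _).
have xJ : x \in ideal_set J by rewrite eJ setU11.
have mems y : (y \in s) = (y \in last J p :\: J) by rewrite (perm_mem sB) mem_enum.
exists (x :: s); last by rewrite /= (ideal_label_add nxI eJ).
apply/andP; split; last first.
  rewrite /= sw andbT; apply/allP=> y; rewrite mems in_setD => /andP[nyJ _].
  by apply: contra nyJ => /ltW; apply: ideal_down.
apply: uniq_perm; rewrite ?enum_uniq //=.
  by rewrite mems in_setD xJ (perm_uniq sB) enum_uniq.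
move=> y; rewrite in_cons mems mem_enum !in_setD eJ in_setU1.
case: eqVneq => //= ->; rewrite nxI.
by rewrite le_ideal in JB; rewrite (subsetP JB).
Qed.

(** All that lies below the first letter is in I, because J is an ideal, so
    this letter can be added to I; then continue from there. *)
Lemma linear_word_path I J s : (I <= J)%O -> linear_word (J :\: I) s ->
  exists p, [/\ path covers I p, last I p = J &
    pairmap (ideal_label e) I p = [seq (e x : nat) | x <- s]].
Proof.
elim: s I => [|x s IH] I IJ /andP[sB sw].
  have JI : J :\: I = set0.
    by apply/setP=> y; rewrite -mem_enum -(perm_mem sB) inE.
  exists [::]; split=> //=; apply/le_anti; rewrite IJ le_ideal.
  by rewrite -setD_eq0 JI eqxx.
have mems y : (y \in x :: s) = (y \in J :\: I) by rewrite (perm_mem sB) mem_enum.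
have : x \in J :\: I by rewrite -mems mem_head.
rewrite in_setD => /andP[nxI xJ].
have /= /andP[nxs us] : uniq (x :: s) by rewrite (perm_uniq sB) enum_uniq.
have /= /andP[/allP xmin sw'] := sw.
have [|K eK] := ideal_add_minimal IJ xJ.
  by move=> y; rewrite -mems in_cons => /predU1P[->|/xmin//]; rewrite ltxx.
have KJ : (K <= J)%O by rewrite le_ideal eK subUset sub1set xJ -le_ideal.
have [|p [pp lp ep]] := IH K KJ.
  rewrite /linear_word sw' andbT; apply: uniq_perm; rewrite ?enum_uniq // => y.
  have := mems y; rewrite mem_enum in_cons !in_setD eK in_setU1.
  by case: eqVneq => //= ->; rewrite (negbTE nxs).
exists (K :: p); split=> //=; last by rewrite ep (ideal_label_add nxI eK).
by rewrite pp andbT; apply/ideal_coversP; exists x.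
Qed.

Hypothesis e_inj : injective e.

Lemma path_label_inj I p q : path covers I p -> path covers I q ->
  pairmap (ideal_label e) I p = pairmap (ideal_label e) I q -> p = q.
Proof.
elim: p I q => [|J p IH] I [|K q] //= /andP[IJ pp] /andP[IK pq].
case/ideal_coversP: IJ => x nxI eJ; case/ideal_coversP: IK => y nyI eK [].
rewrite (ideal_label_add nxI eJ) (ideal_label_add nyI eK) => /val_inj/e_inj exy.
have {eK} eK : K = J by apply/val_inj; rewrite /= eJ eK exy.
by subst K => /(IH _ _ pp pq)->.
Qed.

Lemma linear_word_swap A s1 x y s2 : ~~ (y < x)%O ->
  linear_word A (s1 ++ y :: x :: s2) -> linear_word A (s1 ++ x :: y :: s2).
Proof.
move=> nyx /andP[sA]; rewrite /linear_word !pairwise_cat /= !allrel_consr.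
move=> /and3P[/and3P[-> -> ->] -> /and3P[/andP[_ ->] -> ->]].
rewrite !andbT /= nyx andbT -(permPl (_ : perm_eq (s1 ++ y :: x :: s2) _)) //.
by rewrite perm_cat2l (permEl (perm_catCA [:: y] [:: x] s2)).
Qed.

End IdealCovers.

(** * The EL-labeling and the polygon moves *)

Section PolygonMoves.
Context {d : Order.disp_t} {P : finPOrderType d} {n : nat} (e : P -> 'I_n).
Hypothesis he : linear_extension e.
Implicit Types (I J : ideal P) (m : max_chain (ideal P)).

Let e_inj : injective e := bij_inj he.1.

Lemma linext_not_lt x y : e x < e y -> ~~ (y < x)%O.
Proof. by move=> lt; apply: contraL lt => /ltW/he.2; rewrite leqNgt. Qed.

(** Sorting by e respects the order of P because e is a linear extension. *)
Lemma increasing_word I J : exists2 s, linear_word (J :\: I) s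
  & sorted leq ([seq (e x : nat) | x <- s]).
Proof.
pose r := relpre (fun x => e x : nat) leq.
have srt : sorted leq (map (fun x => e x : nat) (sort r (enum (J :\: I)))).
  by rewrite sorted_map; apply: sort_sorted => x y; apply: leq_total.
exists (sort r (enum (J :\: I))) => //.
rewrite /linear_word perm_sort perm_refl /=.
have un : uniq (map (fun x => e x : nat) (sort r (enum (J :\: I)))).
  by rewrite map_inj_uniq ?sort_uniq ?enum_uniq // => x y /val_inj/e_inj.
have : sorted ltn (map (fun x => e x : nat) (sort r (enum (J :\: I)))).
  by rewrite ltn_sorted_uniq_leq un.
rewrite (sorted_pairwise ltn_trans) pairwise_map; apply: sub_pairwise.
by move=> x y; apply: linext_not_lt.
Qed.

Lemma path_label_perm I J p q : path covers I p -> path covers I q ->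
  last I p = J -> last I q = J ->
  perm_eq (pairmap (ideal_label e) I p) (pairmap (ideal_label e) I q).
Proof.
move=> /(path_linear_word e)[s /andP[sp _] ->].
move=> /(path_linear_word e)[t /andP[tp _] ->] lp lq.
by apply: perm_map; rewrite (permPl sp) lp -lq perm_sym.
Qed.

(** All maximal chains of [I, J] have label sequences with the same letters;
    only one of these is increasing, and it is the least one. *)
Lemma ideal_label_EL : EL_labeling (ideal_label e).
Proof.
move=> I J IJ; have leIJ := ltW IJ.
have [s sw ss] := increasing_word I J.
have [p [pp lp ep]] := linear_word_path e leIJ sw.
exists [set:: I :: p].
  apply/andP; split; first by apply/max_chain_ofP => //; exists p.
  by rewrite /ascending label_seq_path // ep.
move=> c /(max_chain_ofP _ leIJ)[q [pq lq ->]] ne.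
(* Different chains have different labels, hence the strict inequality. *)
have npq : pairmap (ideal_label e) I p <> pairmap (ideal_label e) I q.
  by move/(path_label_inj e_inj pp pq) => epq; rewrite epq eqxx in ne.
have perm := path_label_perm pp pq lp lq.
have ss' : sorted <=%O (pairmap (ideal_label e) I p) by rewrite ep.
rewrite /ascending !label_seq_path //; split.
  by apply/negP=> sq; apply: npq; apply: le_sorted_eq.
rewrite lt_neqAle sorted_lexi_min // andbT.
exact/eqP.
Qed.

(** Outside [I, K] the two chains agree.  Inside, their label sequences are
    rearrangements of each other: m' has two labels, in decreasing order, and
    m is ascending, so it has the same two labels in increasing order. *)
Lemma polygon_move_ascent_swap m m' : polygon_move (ideal_label e) m m' ->
  ascent_swap (label_seq (ideal_label e) (val m))
              (label_seq (ideal_label e) (val m')).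
Proof.
case/exists_inP=> I /setIP[Im Im'] /exists_inP[K /setIP[Km Km']].
case/and5P=> IK /eqP eb /eqP ea /existsP[J /and3P[/and3P[IJ JK dsc] /eqP em' _]].
case/and3P=> _ asc _; have leIK := ltW IK.
have [p [pp lp ep ->]] := max_chain_split (ideal_label e) Im Km leIK.
have [q [pq lq eq ->]] := max_chain_split (ideal_label e) Im' Km' leIK.
rewrite eb ea; set l1 := label_seq _ _; set l3 := label_seq _ _.
have pJ : path covers I [:: J; K] by rewrite /= IJ JK.
have Eq : q = [:: J; K].
  have : [set:: I :: q] = [set:: [:: I; J; K]].
    by rewrite -eq em'; apply/setP=> w; rewrite !inE orbA.
  move/(congr1 (fun c : {set ideal P} => sort <=%O (enum c))).
  by rewrite !sort_enum_path ?path_covers_lt // => -[].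
subst q; have perm := path_label_perm pp pq lp lq.
move: asc; rewrite /ascending ep label_seq_path // => asc.
move: perm dsc => /=; set b := ideal_label e I J; set a := ideal_label e J K.
move=> perm; rewrite -ltNge => ab.
have -> : pairmap (ideal_label e) I p = [:: a; b].
  apply: le_sorted_eq => //=; first by rewrite andbT ltW.
  by rewrite (permPl perm); exact: permEl (perm_rev [:: a; b]).
by exists l1, a, b, l3.
Qed.

(** Equal labels force equal ideals up to I, the ideal reached after the common
    prefix.  Both chains then add the same two elements u and v, in opposite
    orders, so they meet again at K and agree from there on. *)
Lemma ascent_swap_polygon_move m m' :
  ascent_swap (label_seq (ideal_label e) (val m))
              (label_seq (ideal_label e) (val m')) ->
  polygon_move (ideal_label e) m m'.
Proof.
have [p [pp _ em]] := max_chain_path m.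
have [q [pq _ em']] := max_chain_path m'.
rewrite em em' !label_seq_path // => -[l1 [a [b [l3 [ab Lp Lq]]]]].
have [p1 [[|J [|K p3]] [Ep lp1 //]]] := pairmap_eq_cat Lp; case=> ea eb ep3.
have [q1 [[|J' [|K' q3]] [Eq lq1 //]]] := pairmap_eq_cat Lq; case=> ea' eb' eq3.
subst p q.
(* Equal label prefixes come from equal initial segments. *)
have epq1 : q1 = p1.
  apply: (path_label_inj e_inj (I := \bot%O)); last by rewrite lq1.
    by move: pq; rewrite cat_path => /andP[].
  by move: pp; rewrite cat_path => /andP[].
subst q1; move: (pp) (pq); rewrite !cat_path /=; set I := last _ p1.
case/andP=> _ /and3P[IJ JK p3P] /andP[_ /and3P[IJ' JK' q3P]].
have [u nuI eJ] := ideal_coversP _ _ IJ.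
have [v nvJ eK] := ideal_coversP _ _ JK.
have [v' nvI eJ'] := ideal_coversP _ _ IJ'.
have [u' nuJ eK'] := ideal_coversP _ _ JK'.
rewrite (ideal_label_add e nuI eJ) in ea.
rewrite (ideal_label_add e nvJ eK) in eb.
rewrite (ideal_label_add e nvI eJ') in ea'.
rewrite (ideal_label_add e nuJ eK') in eb'.
have ? : v' = v by apply/e_inj/val_inj; rewrite /= ea' eb.
have ? : u' = u by apply/e_inj/val_inj; rewrite /= ea eb'.
subst u' v'.
(* Adding v and then u gives the same ideal as adding u and then v. *)
have ? : K' = K by apply/val_inj; rewrite /= eK' eK eJ eJ' setUCA.
subst K'; have ? : q3 = p3 by apply: (path_label_inj e_inj q3P p3P); rewrite ep3.
subst q3.
have IK : (I < K)%O := lt_trans (covers_lt IJ) (covers_lt JK).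
have := chain_split3 (p2 := [:: J; K]) pp.
have := chain_split3 (p2 := [:: J'; K]) pq.
rewrite /= -/I => -[B' A' [C' Im' Km']] [B A [C Im Km]].
rewrite -em in B A C Im Km; rewrite -em' in B' A' C' Im' Km'.
rewrite /polygon_move; apply/exists_inP; exists I; first exact/setIP.
apply/exists_inP; exists K; first exact/setIP.
rewrite B B' A A' C C' !eqxx IK /=; apply/andP; split.
  apply/existsP; exists J'; rewrite /descent IJ' JK' -ltNge.
  rewrite (ideal_label_add e nvI eJ') (ideal_label_add e nuJ eK') ea' eb'.
  rewrite ltEnat /= ab /=.
  apply/andP; split; first by apply/eqP/setP=> w; rewrite !inE orbA.
  have J'itv := covers_mem_itv IJ' JK'.
  apply/negP=> J'm.
  have : J' \in [set:: [:: I; J; K]] by rewrite -C in_setI J'm.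
  rewrite in_set !inE => /or3P[]/eqP E.
  - by have := covers_lt IJ'; rewrite E ltxx.
  - have : u \in ideal_set J' by rewrite E eJ setU11.
    rewrite eJ' in_setU1 (negbTE nuI) orbF => /eqP uv.
    by move: ab; rewrite -ea -eb uv ltnn.
  - by have := covers_lt JK'; rewrite E ltxx.
have pIK : path covers I [:: J; K] by rewrite /= IJ JK.
have mc : max_chain_of (itv I K) [set:: [:: I; J; K]].
  exact: path_max_chain pIK.
have asc : ascending (ideal_label e) [set:: [:: I; J; K]].
  rewrite /ascending label_seq_path //= (ideal_label_add e nuI eJ).
  by rewrite (ideal_label_add e nvJ eK) ea eb leEnat (ltnW ab).
rewrite /unique_ascending_chain mc asc /=.
(* An EL-labeling has at most one ascending chain in [I, K]. *)
have [c _ other] := ideal_label_EL IK.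
have uniq_c c' :
  max_chain_of (itv I K) c' -> ascending (ideal_label e) c' -> c' = c.
  by move=> h a'; apply/eqP; apply: contraTT a' => /(other _ h)[].
apply/forallP=> c'; apply/implyP=> /andP[h a'].
by rewrite (uniq_c _ h a') (uniq_c _ mc asc).
Qed.

End PolygonMoves.

(** * The weak order as the closure of ascent swaps *)

Section WeakOrder.
Context {n : nat}.
Implicit Types (u v w : 'S_n) (i j : 'I_n).

(** Multiplication by a simple transposition at an ascent: these are the cover
    relations of the weak order ([weak_stepP], [weak_le_connect]). *)
Definition weak_step : rel 'S_n := fun u v =>
  [exists i : 'I_n, exists j : 'I_n,
    [&& j == i.+1 :> nat, u i < u j & v == (tperm i j * u)%g]].

Lemma tperm_ltn i j (a b : 'I_n) : j = i.+1 :> nat -> (a, b) != (i, j) ->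
  a < b -> tperm i j a < tperm i j b.
Proof.
move=> eij; rewrite xpair_eqE -!(inj_eq val_inj) /=.
by case: tpermP => [->|->|/eqP + /eqP]; case: tpermP => [->|->|/eqP + /eqP];
  rewrite -?(inj_eq val_inj) /=; lia.
Qed.

(** Relabeling both positions by s = (i, i + 1) matches the inversions of u with
    those of us, except that us has the additional inversion (i, j): no other
    pair of positions changes its relative order ([tperm_ltn]). *)
Lemma inversion_number_ascent u i j : j = i.+1 :> nat -> u i < u j ->
  inversion_number (tperm i j * u)%g = (inversion_number u).+1.
Proof.
move=> eij uij; set s := tperm i j.
pose f (x : 'I_n * 'I_n) := (s x.1, s x.2).
have fK : involutive f by case=> a b; rewrite /f /= !tpermK.
have [si sj] : s i = j /\ s j = i by rewrite /s tpermL tpermR.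
rewrite /inversion_number (cardsD1 (i, j)) inE /= !permM si sj.
rewrite uij eij ltnSn add1n; congr _.+1.
rewrite -(card_imset _ (inv_inj fK)); apply: eq_card => -[a b].
rewrite -[X in (X \in _) = _](fK (a, b)) mem_imset; last exact: inv_inj fK.
rewrite !inE /= !permM /s !tpermK -/s.
have ne0 : u b < u a -> (a, b) != (i, j).
  by move=> uab; apply: contraTneq uab => -[-> ->]; rewrite -leqNgt ltnW.
apply/andP/andP => [[ne /andP[sab uab]]|[ab uab]]; last first.
  rewrite uab (tperm_ltn eij (ne0 uab) ab); split=> //.
  apply: contraTneq ab => -[sa sb].
  by rewrite -[a](tpermK i j) -[b](tpermK i j) -/s sa sb si sj eij -leqNgt.
split=> //; have := tperm_ltn eij ne sab.
by rewrite /s !tpermK.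
Qed.

(** At a descent the transposition removes an inversion, as seen by applying
    [inversion_number_ascent] to the product. *)
Lemma weak_stepP u v : reflect
  (exists2 s, simple_transposition s &
     v = (s * u)%g /\ inversion_number v = (inversion_number u).+1)
  (weak_step u v).
Proof.
apply: (iffP existsP) => [[i /existsP[j /and3P[/eqP eij uij /eqP->]]]|].
  exists (tperm i j); last by rewrite inversion_number_ascent.
  by apply/existsP; exists i; apply/existsP; exists j; rewrite eij !eqxx.
case=> s /existsP[i /existsP[j /andP[/eqP eij /eqP->]]] [-> inv].
exists i; apply/existsP; exists j; rewrite eij !eqxx andbT /=.
case: (ltngtP (u i) (u j)) => // [uji|/val_inj/perm_inj]; last first.
  by move=> E; move/eqP: (eij); rewrite E eqn_leq ltnn andbF.
have := @inversion_number_ascent (tperm i j * u)%g i j eij.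
rewrite !permM tpermL tpermR mulgA tperm2 mul1g => /(_ uji) inv'.
by move: (leqnSn (inversion_number u)); rewrite -inv inv' ltnn.
Qed.

Lemma weak_le_connect u w : weak_le u w <-> connect weak_step u w.
Proof.
split.
  case=> ss []; elim: ss u => [|s ss IH] u /=; first by move=> _ -> _; apply: connect0.
  case/andP=> hs hss ew inv.
  have inv1 := inv 1 isT; rewrite /= take0 /= addn1 in inv1.
  apply: (connect_trans (y := (s * u)%g)).
    by apply: connect1; apply/weak_stepP; exists s.
  apply: (IH _ hss ew) => j jss; rewrite inv1 addSnnS.
  by case/andP: jss => _ jss; apply: (inv j.+1).
case/connectP=> p; elim: p u => [|v p IH] u /=.
  by move=> _ ->; exists [::]; split=> // -[].
case/andP=> /weak_stepP[s hs [-> inv]] pp lp.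
have [ss [hss ew invs]] := IH _ pp lp.
exists (s :: ss); split; rewrite /= ?hs //.
case=> // -[|j] jss; first by rewrite /= take0 /= addn1.
by rewrite -addSnnS -inv; apply: invs.
Qed.

Lemma one_line_inj : injective (@one_line n).
Proof.
move=> u v /eq_in_map h; apply/permP=> i; apply/val_inj/h.
exact: mem_enum.
Qed.

Lemma size_one_line u : size (one_line u) = n.
Proof. by rewrite size_map size_enum_ord. Qed.

Lemma nth_one_line u i : nth 0 (one_line u) i = u i.
Proof. by rewrite (nth_map i) ?size_enum_ord // nth_ord_enum. Qed.

Lemma one_line_surj (s : seq 'I_n) : uniq s -> size s = n ->
  exists w : 'S_n, one_line w = map val s.
Proof.
move=> us ss; pose g i := tnth (in_tuple s) (cast_ord (esym ss) i).
have g_inj : injective g.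
  move=> i j; rewrite /g !(tnth_nth i) /= => /eqP.
  by rewrite nth_uniq ?ss // => /eqP/val_inj.
exists (perm g_inj); apply: (@eq_from_nth _ 0).
  by rewrite size_one_line size_map.
move=> k; rewrite size_one_line => kn; rewrite -[k]/(val (Ordinal kn)) nth_one_line.
by rewrite permE /g (tnth_nth (Ordinal kn)) /= (nth_map (Ordinal kn)) ?ss.
Qed.

Lemma one_line_tperm u i j l1 a b l2 : j = i.+1 :> nat -> size l1 = i ->
  one_line u = l1 ++ a :: b :: l2 ->
  one_line (tperm i j * u)%g = l1 ++ b :: a :: l2.
Proof.
move=> eij sl1 eu; apply: (@eq_from_nth _ 0).
  by rewrite size_one_line -(size_one_line u) eu !size_cat.
have ea : a = u i by rewrite -nth_one_line eu nth_cat sl1 ltnn subnn.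
have eb : b = u j.
  by rewrite -nth_one_line eu nth_cat sl1 eij ltnNge leqnSn subSn // subnn.
move=> k; rewrite size_one_line => kn; set k' := Ordinal kn.
rewrite -[k in LHS]/(val k') nth_one_line permM.
case: tpermP => [ki|kj|/eqP nki /eqP nkj].
- have -> : k = i by rewrite -ki.
  by rewrite nth_cat sl1 ltnn subnn.
- have -> : k = i.+1 by rewrite -eij -kj.
  by rewrite nth_cat sl1 ltnNge leqnSn subSn // subnn.
rewrite -nth_one_line eu !nth_cat sl1 /=; case: ltnP => // ik.
have : k != i by [].
have : k != i.+1 by rewrite -eij.
case E : (k - i) => [|[|?]] //=; lia.
Qed.

Lemma weak_step_swap u v : weak_step u v <-> ascent_swap (one_line u) (one_line v).
Proof.
split.
  case/existsP=> i /existsP[j /and3P[/eqP eij uij /eqP->]].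
  have iu : i < size (one_line u) by rewrite size_one_line.
  have ju : i.+1 < size (one_line u) by rewrite size_one_line -eij.
  have eu := cat_take_drop i (one_line u).
  rewrite (drop_nth 0 iu) (drop_nth 0 ju) -{1}eij !nth_one_line in eu.
  exists (take i (one_line u)), (u i), (u j), (drop i.+2 (one_line u)).
  split=> //; apply: one_line_tperm => //.
  by rewrite size_takel // ltnW.
case=> l1 [a [b [l2 [ab eu ev]]]].
have sz : size l1 + (size l2).+2 = n by rewrite -(size_one_line u) eu size_cat.
have in_ : size l1 < n by lia.
have jn : (size l1).+1 < n by lia.
pose i := Ordinal in_; pose j := Ordinal jn.
apply/existsP; exists i; apply/existsP; exists j; rewrite eqxx /=.
apply/andP; split; last first.
  by apply/eqP/one_line_inj; rewrite ev; symmetry; apply: one_line_tperm eu.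
by rewrite -!nth_one_line eu !nth_cat /= ltnn subnn [_.+1 < _]ltnNge leqnSn subSnn.
Qed.

End WeakOrder.

(** * The label sequences form an order ideal *)

Section LinearExtensionPermutations.
Context {d : Order.disp_t} {P : finPOrderType d} {n : nat} (e : P -> 'I_n).
Hypothesis he : linear_extension e.
Implicit Types (m : max_chain (ideal P)) (u v w : 'S_n).

Let e_inj : injective e := bij_inj he.1.

Lemma full_interval :
  ideal_set (\top%O : ideal P) :\: ideal_set (\bot%O : ideal P) = [set: P].
Proof. by rewrite ideal0 ideal1 setD0. Qed.

Lemma max_chain_word m : exists2 s, linear_word [set: P] s &
  label_seq (ideal_label e) (val m) = [seq (e x : nat) | x <- s].
Proof.
have [p [pp lp ->]] := max_chain_path m.
have [s sw es] := path_linear_word e pp.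
by exists s; [rewrite lp full_interval in sw | rewrite label_seq_path].
Qed.

Lemma word_max_chain s : linear_word [set: P] s -> exists m,
  label_seq (ideal_label e) (val m) = [seq (e x : nat) | x <- s].
Proof.
rewrite -full_interval => /(linear_word_path e (le0x _))[p [pp lp ep]].
have mc : max_chain_of [set: ideal P] [set:: \bot%O :: p].
  suff -> : [set: ideal P] = itv \bot%O (last \bot%O p) by apply: path_max_chain.
  by apply/setP=> x; rewrite lp !inE le0x lex1.
exists (exist (fun c => max_chain_of [set: ideal P] c) _ mc).
by rewrite /= label_seq_path.
Qed.

Lemma label_seq_inj m m' :
  label_seq (ideal_label e) (val m) = label_seq (ideal_label e) (val m') -> m = m'.
Proof.
have [p [pp _ em]] := max_chain_path m; have [q [pq _ em']] := max_chain_path m'.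
rewrite em em' !label_seq_path // => /(path_label_inj e_inj pp pq) epq.
by apply/val_inj; rewrite em em' epq.
Qed.

Lemma max_chain_perm m : exists w : 'S_n,
  one_line w = label_seq (ideal_label e) (val m).
Proof.
have [s /andP[sP _] ->] := max_chain_word m.
have [||w ew] := @one_line_surj n (map e s).
- by rewrite (map_inj_uniq e_inj) (perm_uniq sP) enum_uniq.
- by rewrite size_map (perm_size sP) -cardE cardsT (bij_eq_card he.1) card_ord.
by exists w; rewrite ew -map_comp.
Qed.

Lemma linext_permsP w : reflect
  (exists m, one_line w = label_seq (ideal_label e) (val m))
  (w \in linext_perms e).
Proof.
by rewrite inE; apply: (iffP existsP) => -[m /eqP]; exists m => //; apply/eqP.
Qed.

(** In a descent b, a of a label sequence, the element y labeled b cannot be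
    below the element x labeled a, as e is order preserving and a < b.  So the
    chain may add x before y. *)
Lemma weak_step_linext_perms u v :
  weak_step u v -> v \in linext_perms e -> u \in linext_perms e.
Proof.
move/weak_step_swap=> [l1 [a [b [l2 [ab eu ev]]]]] /linext_permsP[m].
rewrite ev; have [s sw ->] := max_chain_word m => /esym.
case/map_cat_inv=> s1 [[|y [|x s2]] [es es1 //]] [ey ex es2].
rewrite {}es in sw.
have nyx : ~~ (y < x)%O by apply: (linext_not_lt he); rewrite ex ey.
have [m' em'] := word_max_chain (linear_word_swap nyx sw).
by apply/linext_permsP; exists m'; rewrite em' eu map_cat /= ex ey es1 es2.
Qed.

Lemma connect_weak_linext_perms u v :
  connect weak_step u v -> v \in linext_perms e -> u \in linext_perms e.
Proof.
case/connectP=> p; elim: p u => [|x p IH] u /=; first by move=> _ ->.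
by case/andP=> ux xp ev /(IH _ xp ev); apply: weak_step_linext_perms.
Qed.

End LinearExtensionPermutations.

Theorem theorem6p6 (d : Order.disp_t) (P : finPOrderType d) (n : nat)
    (hn : #|P| = n) (e : P -> 'I_n) (he : linear_extension e) :
  [/\ EL_labeling (ideal_label e),
      (forall u w : 'S_n,
         weak_le u w -> w \in linext_perms e -> u \in linext_perms e) &
      exists f : max_chain (ideal P) -> {w : 'S_n | w \in linext_perms e},
        [/\ bijective f,
            (forall m, one_line (val (f m))
                       = label_seq (ideal_label e) (val m)) &
            (forall m m', mcd_le (ideal_label e) m m'
                          <-> weak_le (val (f m)) (val (f m')))]].
Proof.
split; first exact: ideal_label_EL.
  by move=> u w /weak_le_connect; apply: connect_weak_linext_perms.
have f_ex (m : max_chain (ideal P)) :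
    exists w : {w : 'S_n | w \in linext_perms e},
    one_line (val w) == label_seq (ideal_label e) (val m).
  have [w ew] := max_chain_perm he m.
  have wL : w \in linext_perms e by apply/linext_permsP; exists m.
  by exists (exist _ w wL); apply/eqP.
have g_ex (w : {w : 'S_n | w \in linext_perms e}) :
    exists m : max_chain (ideal P),
    one_line (val w) == label_seq (ideal_label e) (val m).
  by have /linext_permsP[m ->] := valP w; exists m.
pose f m := xchoose (f_ex m); pose g w := xchoose (g_ex w).
have fE m : one_line (val (f m)) = label_seq (ideal_label e) (val m).
  exact/eqP/(xchooseP (f_ex m)).
have gE w : one_line (val w) = label_seq (ideal_label e) (val (g w)).
  exact/eqP/(xchooseP (g_ex w)).
have gK w : f (g w) = w by apply/val_inj/one_line_inj; rewrite fE gE.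
exists f; split=> //.
  exists g => // m; apply: (label_seq_inj he); by rewrite -gE fE.
have stepE m m' : polygon_move (ideal_label e) m m' <->
    weak_step (val (f m)) (val (f m')).
  apply: (iff_trans _ (iff_sym (weak_step_swap _ _))); rewrite !fE.
  split; [exact: polygon_move_ascent_swap | exact: ascent_swap_polygon_move].
move=> m m'; apply: (iff_trans _ (iff_sym (weak_le_connect _ _))); split.
  case/connectP=> p; elim: p m => [|x p IH] m /=; first by move=> _ ->; apply: connect0.
  case/andP=> /stepE mx xp ex; exact: connect_trans (connect1 mx) (IH _ xp ex).
case/connectP=> p; elim: p m => [|x p IH] m /=.
  move=> _ /val_inj E; suff -> : m' = m by apply: connect0.
  by apply: (label_seq_inj he); rewrite -!fE E.
case/andP=> mx xp ex.
(* The rest of the path leads from x up to an element of L(P, e), so x is in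
   L(P, e) too and the path can be lifted to maximal chains. *)
have xL : x \in linext_perms e.
  apply: (@connect_weak_linext_perms _ _ _ _ he _ (val (f m'))); last exact: valP.
  by apply/connectP; exists p.
have Ex : val (f (g (exist _ x xL))) = x by rewrite gK.
rewrite -Ex in mx xp ex.
exact: connect_trans (connect1 (proj2 (stepE _ _) mx)) (IH _ xp ex).
Qed.
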